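(* Let $H$ satisfy the standing assumptions (H). For $\mu>0$ and $m\in\mathscr C^{1,2}_{\mathrm{per}}((0,T)\times\mathbb T^d)$ let $\lambda_H(m,\mu)$ be the eigenvalue of $\partial_t+\mu(-\Delta+H(\nabla_x\cdot))+m$. Then there exists $m\in\mathscr C^{1,2}_{\mathrm{per}}((0,T)\times\mathbb T^d)$ such that $\mu\mapsto\lambda_H(m,\mu)$ is not monotonic on $(0,\infty)$.
   Context: $\mathbb T^d$ is the $d$-dimensional torus and $T>0$ is fixed. $\mathscr C^{1,2}_{\mathrm{per}}((0,T)\times\mathbb T^d)$ denotes functions that are $T$-periodic in $t$, $\mathbb T^d$-periodic in $x$, $\mathscr C^1$ in $t$ and $\mathscr C^2$ in $x$. Standing assumptions (H) on $H:\mathbb R^d\to\mathbb R$: $H$ is $\mathscr C^2$; $H(p)>H(0)=0$ for $p\neq0$; $\nabla^2_{pp}H(p)$ is symmetric positive definite for $p\neq 0$; there is a continuous, coercive, convex, non-negative function $\mathcal H$ on $[0,\infty)$ with $\mathcal H(a)>\mathcal H(0)=0$ for $a>0$ such that $\mathcal H\big(\|f-\frac{1}{|\mathbb T^d|}\int_{\mathbb T^d}f\|_{L^1(\mathbb T^d)}\big)\le\int_{\mathbb T^d}H(\nabla f)$ for every $f\in\mathscr C^2(\mathbb T^d)$; and there is $\beta\in(0,1)$ with $aH(p)\ge H(a^\beta p)$ for all $a\in(0,1)$, $p\in\mathbb R^d$. Eigenvalue: the eigenvalue of $\partial_t+\mu(-\Delta+H(\nabla_x\cdot))+m$ is the unique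 real $\lambda$ for which there exists $\varphi\in\mathscr C^{1,2}_{\mathrm{per}}((0,T)\times\mathbb T^d)$ with $\lambda+\partial_t\varphi+\mu(-\Delta\varphi+H(\nabla_x\varphi))=-m$. *)

(* Defs.v *)
From HB Require Import structures.
From mathcomp Require Import all_boot all_order all_algebra.
From mathcomp Require Import all_classical all_reals all_analysis.
Set Implicit Arguments. Unset Strict Implicit. Unset Printing Implicit Defensive.
Import Order.TTheory GRing.Theory Num.Theory.
Import numFieldNormedType.Exports.
Local Open Scope classical_set_scope.
Local Open Scope ring_scope.

Section Defs.
Variable R : realType.

Definition e_ (d : nat) (i : 'I_d) : 'rV[R]_d := delta_mx 0 i.

Definition pd (d : nat) (i : 'I_d) (f : 'rV[R]_d -> R) (x : 'rV[R]_d) : R :=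
  'D_(e_ i) f x.
Definition grad (d : nat) (f : 'rV[R]_d -> R) (x : 'rV[R]_d) : 'rV[R]_d :=
  \row_i pd i f x.
Definition lap (d : nat) (f : 'rV[R]_d -> R) (x : 'rV[R]_d) : R :=
  \sum_(i < d) pd i (pd i f) x.
Definition hess (d : nat) (f : 'rV[R]_d -> R) (x : 'rV[R]_d) : 'M[R]_d :=
  \matrix_(i, j) pd i (pd j f) x.

Definition C2 (d : nat) (f : 'rV[R]_d -> R) : Prop :=
  continuous f /\
  (forall i x, derivable f x (e_ i)) /\ (forall i, continuous (pd i f)) /\
  (forall i j x, derivable (pd j f) x (e_ i)) /\
  (forall i j, continuous (pd i (pd j f))).

(* Z^d-periodic, i.e. a function on the torus T^d = R^d / Z^d *)
Definition periodic_x (d : nat) (f : 'rV[R]_d -> R) : Prop :=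
  forall i x, f (x + e_ i) = f x.

Definition dt (d : nat) (u : R -> 'rV[R]_d -> R) (t : R) (x : 'rV[R]_d) : R :=
  derive1 (fun s => u s x) t.

Definition uncurry2 (d : nat) (u : R -> 'rV[R]_d -> R) : R * 'rV[R]_d -> R :=
  fun p => u p.1 p.2.

Definition C12per (T : R) (d : nat) (u : R -> 'rV[R]_d -> R) : Prop :=
  (forall t x, u (t + T) x = u t x) /\
  (forall t, periodic_x (u t)) /\
  continuous (uncurry2 u) /\
  (forall t x, derivable (fun s => u s x) t 1) /\
  continuous (uncurry2 (dt u)) /\
  (forall i t x, derivable (u t) x (e_ i)) /\
  (forall i, continuous (uncurry2 (fun t => pd i (u t)))) /\
  (forall i j t x, derivable (pd j (u t)) x (e_ i)) /\
  (forall i j, continuous (uncurry2 (fun t => pd i (pd j (u t))))).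

(* integral over the unit cube [0,1]^d (a fundamental domain of T^d, |T^d| = 1),
   as an iterated Lebesgue integral *)
Fixpoint cube_int (d : nat) : ('rV[R]_d -> R) -> R :=
  match d with
  | 0 => fun f => f 0
  | n.+1 => fun f =>
      \int[@lebesgue_measure R]_(s in `[0, 1]%classic)
        cube_int (fun y : 'rV[R]_n => f (row_mx (\row_(k < 1) s) y))
  end.

Definition assumptions_H (d : nat) (H : 'rV[R]_d -> R) : Prop :=
  C2 H /\
  H 0 = 0 /\ (forall p, p != 0 -> H p > 0) /\
  (forall p, p != 0 ->
     (hess H p)^T = hess H p /\
     forall v : 'rV[R]_d, v != 0 -> (v *m hess H p *m v^T) 0 0 > 0) /\
  (exists cH : R -> R,
     {within `[0, +oo[%classic, continuous cH} /\
     (cH x @[x --> +oo] --> +oo) /\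
     (forall a b l, 0 <= a -> 0 <= b -> 0 <= l <= 1 ->
        cH (l * a + (1 - l) * b) <= l * cH a + (1 - l) * cH b) /\
     (forall a, 0 <= a -> 0 <= cH a) /\
     cH 0 = 0 /\ (forall a, 0 < a -> cH a > 0) /\
     (forall f : 'rV[R]_d -> R, C2 f -> periodic_x f ->
        cH (cube_int (fun x => `| f x - cube_int f |))
          <= cube_int (fun x => H (grad f x)))) /\
  (exists beta : R, 0 < beta < 1 /\
     forall a p, 0 < a < 1 -> a * H p >= H ((a `^ beta) *: p)).

Definition is_eigenvalue (T : R) (d : nat) (H : 'rV[R]_d -> R) (mu : R)
    (m : R -> 'rV[R]_d -> R) (lam : R) : Prop :=
  exists phi : R -> 'rV[R]_d -> R, C12per T phi /\
    forall t x,
      lam + dt phi t x + mu * (- lap (phi t) x + H (grad (phi t) x)) = - m t x.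

End Defs.

(* Main.v *)
(* Take the travelling wave m(t,x) = cos(2 pi (x_1 - t/T)). Looking for
   phi(t,x) = F(x_1 - t/T) turns the eigenvalue problem into finding, for every mu,
   a constant lambda and a 1-periodic v = F' of mean zero with
     mu v' = mu H(v e_1) - v/T + lambda + cos(2 pi z).
   After truncation of the nonlinearity this is solved by shooting in the initial
   value and in lambda; a periodic solution of mean zero vanishes somewhere and v' is
   bounded below since H is superlinear, so v is bounded independently of the
   truncation. Integrating the equation gives lambda(mu) < 0. On the other hand both
   the time mean and the space mean of m vanish, so that test functions psi with
   dt psi = -m, respectively mu lap psi = m, and the maximum principle show that
   lambda(mu) tends to 0 as mu -> 0 and as mu -> oo: lambda is not monotonic. *)
Require Import Defs.
From HB Require Import structures.
From mathcomp Require Import all_boot all_order all_algebra.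
From mathcomp Require Import all_classical all_reals all_analysis.
From mathcomp Require Import ring lra.
Import Order.TTheory GRing.Theory Num.Theory.
Import numFieldNormedType.Exports.
Local Open Scope classical_set_scope.
Local Open Scope ring_scope.

(** * Primitives of continuous functions *)

Section Primitives.
Set Implicit Arguments. Unset Strict Implicit.
Context {R : realType}.
Implicit Types (F G f g : R -> R) (a b k : R).

(** Carrying the derivative as an explicit function lets the rules below compose by hand-picked
    right-hand sides, which [eq_primitive] then rewrites to the desired form. *)
Definition primitive F f := forall x : R, is_derive x 1 F (f x).

Lemma primitive_continuous F f : primitive F f -> continuous F.
Proof.
by move=> Ff x; apply/differentiable_continuous/derivable1_diffP; case: (Ff x).
Qed.

Lemma eq_primitive F f g : f =1 g -> primitive F f -> primitive F g.
Proof. by move=> fg Ff x; rewrite -fg. Qed.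

Lemma primitive_unique F f g : primitive F f -> primitive F g -> f =1 g.
Proof. by move=> Ff Fg x; have [_ <-] := Ff x; have [_ <-] := Fg x. Qed.

Lemma primitive_cst k : primitive (fun=> k) (fun=> 0).
Proof. by move=> x; exact: is_derive_cst. Qed.

Lemma primitive_id : primitive (fun x => x) (fun=> 1).
Proof. by move=> x; exact: is_derive_id. Qed.

Lemma primitiveD F G f g : primitive F f -> primitive G g ->
  primitive (fun x => F x + G x) (fun x => f x + g x).
Proof. by move=> Ff Gg x; apply: is_deriveD. Qed.

Lemma primitiveN F f : primitive F f -> primitive (fun x => - F x) (fun x => - f x).
Proof. by move=> Ff x; apply: is_deriveN. Qed.

Lemma primitiveB F G f g : primitive F f -> primitive G g ->
  primitive (fun x => F x - G x) (fun x => f x - g x).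
Proof. by move=> Ff Gg; apply: primitiveD => //; exact: primitiveN. Qed.

Lemma primitiveZ k F f : primitive F f ->
  primitive (fun x => k * F x) (fun x => k * f x).
Proof. by move=> Ff x; apply: is_deriveZ. Qed.

Lemma primitiveM F G f g : primitive F f -> primitive G g ->
  primitive (fun x => F x * G x) (fun x => f x * G x + F x * g x).
Proof.
move=> Ff Gg x; rewrite addrC [f x * _]mulrC.
exact: (@is_deriveM _ _ F G x 1 (f x) (g x)).
Qed.

Lemma primitive_affine k b F f : primitive F f ->
  primitive (fun x => F (k * x + b)) (fun x => k * f (k * x + b)).
Proof.
move=> Ff x.
have D : is_derive x 1 (fun y : R => k * y + b) k.
  have := primitiveD (primitiveZ k primitive_id) (primitive_cst b) x.
  by rewrite mulr1 addr0.
have Fk : is_derive ((fun y : R => k * y + b) x) 1 F (f (k * x + b)) by exact: Ff.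
rewrite mulrC.
exact: (@is_derive1_comp _ F (fun y => k * y + b)).
Qed.

Lemma primitive_shift b F f : primitive F f ->
  primitive (fun x => F (x + b)) (fun x => f (x + b)).
Proof.
by move=> /(primitive_affine 1 b) D x; have := D x; rewrite !mul1r;
   under eq_fun do rewrite mul1r.
Qed.

Lemma primitive_opp F f : primitive F f ->
  primitive (fun x => F (- x)) (fun x => - f (- x)).
Proof.
move=> /(primitive_affine (-1) 0) D x; have := D x; rewrite !mulN1r addr0.
by under eq_fun do rewrite mulN1r addr0.
Qed.

Lemma primitive_expR k : primitive (fun x => expR (k * x)) (fun x => k * expR (k * x)).
Proof.
have E : primitive (@expR R) expR by move=> x; exact: is_derive_expR.
move=> x; have := primitive_affine k 0 E x; rewrite addr0.
by under eq_fun do rewrite addr0.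
Qed.

Lemma primitive_mvt F f a b : primitive F f -> a <= b ->
  exists2 c, a <= c <= b & F b - F a = f c * (b - a).
Proof.
move=> Ff ab; have [||c cab E] := @MVT_segment R F f a b ab.
- by move=> x _; exact: Ff.
- exact/continuous_subspaceT/(primitive_continuous Ff).
- by exists c; rewrite // -(itvP cab).
Qed.

Lemma primitive_le F f a b : primitive F f -> (forall x, a <= x <= b -> 0 <= f x) ->
  a <= b -> F a <= F b.
Proof.
move=> Ff f0 ab; have [c cab E] := primitive_mvt Ff ab.
by rewrite -subr_ge0 E mulr_ge0 ?f0 // subr_ge0.
Qed.

Lemma primitive_lipschitz F f k : primitive F f -> (forall x, `|f x| <= k) ->
  forall a b, `|F a - F b| <= k * `|a - b|.
Proof.
move=> Ff fk a b.
wlog ab : a b / a <= b.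
  move=> wl; case: (leP a b) => [/wl//|/ltW /wl].
  by rewrite distrC [`|b - a|]distrC.
rewrite distrC [`|a - b|]distrC.
by have [c _ ->] := primitive_mvt Ff ab; rewrite normrM ler_wpM2r.
Qed.

(** On the half-line [x >= 0] both [E + F] and [E - F] are nondecreasing; negative [x] follow by
    reflecting [F]. The bound in [|x|] is what the two-sided weight of the Picard iteration
    requires. *)
Lemma primitive_norm_le F E f e : primitive F f -> primitive E e -> F 0 = 0 ->
  (forall x, `|f x| <= e `|x|) -> forall x, `|F x| <= E `|x| - E 0.
Proof.
have pos F' f' E' e' : primitive F' f' -> primitive E' e' -> F' 0 = 0 ->
    (forall x, 0 <= x -> `|f' x| <= e' x) ->
    forall x, 0 <= x -> `|F' x| <= E' x - E' 0.
  move=> Ff Ee F0 fe x x0; rewrite ler_norml; apply/andP; split.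
    suff : E' 0 + F' 0 <= E' x + F' x by lra.
    apply: (primitive_le (primitiveD Ee Ff)) x0 => y /andP[y0 _].
    by have := fe y y0; rewrite ler_norml => /andP[]; lra.
  suff : E' 0 - F' 0 <= E' x - F' x by lra.
  apply: (primitive_le (primitiveB Ee Ff)) x0 => y /andP[y0 _].
  by have := fe y y0; rewrite ler_norml => /andP[]; lra.
move=> Ff Ee F0 fe x; case: (leP 0 x) => x0.
  by rewrite (ger0_norm x0); apply: (pos _ _ _ _ Ff Ee) => // y y0;
    have := fe y; rewrite (ger0_norm y0).
rewrite (ltr0_norm x0) -{1}[x]opprK.
apply: (pos _ _ _ _ (primitive_opp Ff) Ee); rewrite ?oppr0 ?oppr_ge0 ?(ltW x0)//.
by move=> y y0; rewrite normrN; have := fe (- y); rewrite normrN (ger0_norm y0).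
Qed.

Lemma primitive_inj F G f : primitive F f -> primitive G f -> F 0 = G 0 -> F =1 G.
Proof.
move=> Ff Gf FG0 x; apply/eqP; rewrite -subr_eq0 -normr_le0.
rewrite (le_trans (primitive_norm_le (primitiveB Ff Gf) (primitive_cst 0) _ _ x)) ?subrr//.
  by rewrite FG0 subrr.
by move=> y; rewrite subrr normr0.
Qed.

(** The integral from the base point -1 is differentiated only to the right of that point. Starting
    at -1 rather than 0 leaves an overlap around 0 for the gluing. *)
Lemma primitive_half_line f : continuous f -> exists F : R -> R,
  F 0 = 0 /\ forall x : R, - 1 < x -> is_derive x 1 F (f x).
Proof.
move=> cf; pose F x := \int[lebesgue_measure]_(t in `[-1, x]) f t.
exists (fun x => F x - F 0); split; first by rewrite subrr.
move=> x x1; rewrite -[f x]subr0.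
suff Fx : is_derive x 1 F (f x).
  exact: (@is_deriveB _ _ _ F (cst (F 0)) x 1 (f x) 0).
have xu : x < x + 1 by rewrite ltrDl.
have [|dF FE] := @continuous_FTC1_closed R f (-1) x (x + 1) xu _ x1 (cf x).
  apply: continuous_compact_integrable; first exact: segment_compact.
  exact: continuous_subspaceT.
have := derivableP dF; rewrite -derive1E FE; exact.
Qed.

(* Two half-line primitives agree on the overlap (-1, 1), hence glue. *)
Lemma primitive_exists f : continuous f -> exists F, primitive F f /\ F 0 = 0.
Proof.
move=> cf; have [F [F0 dF]] := primitive_half_line cf.
have [|G [G0 dG]] := @primitive_half_line (fun x => - f (- x)).
  move=> x; apply: continuousN; apply: continuous_comp; last exact: cf.
  exact: opp_continuous.
have dG' (x : R) : x < 1 -> is_derive x 1 (fun y => G (- y)) (f x).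
  move=> x1; have N : is_derive x 1 (fun y : R => - y) (- 1) by exact: is_deriveNid.
  have Gx : is_derive ((fun y : R => - y) x) 1 G (- f (- (- x))).
    by apply: dG; rewrite ltrN2.
  have := @is_derive1_comp R G (fun y => - y) x _ _ Gx N.
  by rewrite opprK mulrN1 opprK.
have FG x : -1 < x < 1 -> F x = G (- x).
  move=> x1; apply/eqP; rewrite -subr_eq0.
  pose D y := F y - G (- y).
  have dD (y : R) : -1 < y < 1 -> is_derive y 1 D 0.
    move=> /andP[y1 y2]; rewrite -(subrr (f y)).
    have D1 := dF y y1; have D2 := dG' y y2; exact: (@is_deriveB _ _ _ F (fun y => G (- y)) y 1).
  have D0 : D 0 = 0 by rewrite /D oppr0 F0 G0 subrr.
  have cD y : -1 < y < 1 -> {for y, continuous D}.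
    by move=> /dD[dDy _]; apply/differentiable_continuous/derivable1_diffP.
  case: (leP 0 x) => x0.
    have [||c _] := @MVT_segment R D (fun=> 0) 0 x x0.
    - by move=> y; rewrite in_itv /= => /andP[]; move: x1 => /andP[? ?] ? ?;
        apply: dD; lra.
    - apply: derivable_within_continuous => y; rewrite in_itv /= => /andP[].
      by move: x1 => /andP[? ?] ? ?; have [] := dD y; [lra|].
    by rewrite D0 subr0 mul0r => DE; apply/eqP; exact: DE.
  have [||c _] := @MVT_segment R D (fun=> 0) x 0 (ltW x0).
  - by move=> y; rewrite in_itv /= => /andP[]; move: x1 => /andP[? ?] ? ?;
      apply: dD; lra.
  - apply: derivable_within_continuous => y; rewrite in_itv /= => /andP[].
    by move: x1 => /andP[? ?] ? ?; have [] := dD y; [lra|].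
  by rewrite D0 sub0r mul0r => /eqP; rewrite oppr_eq0 => DE; exact: DE.
exists (fun x => if 0 <= x then F x else G (- x)); rewrite lexx F0; split => // x.
case: (leP 0 x) => x0.
  apply: (near_eq_is_derive _ (f := F)); last by apply: dF; lra.
  have x1 : - 1 < x by lra.
  near=> y; case: (leP 0 y) => // y0; apply/esym/esym/FG.
  have : -1 < y by near: y; exact: lt_nbhsr.
  lra.
apply: (near_eq_is_derive _ (f := fun y => G (- y))); last by apply: dG'; lra.
have x1 : x < 1 by lra.
near=> y; case: (leP 0 y) => // y0; apply/esym/FG.
have : y < 1 by near: y; exact: lt_nbhsl.
lra.
Unshelve. all: by end_near. Qed.

End Primitives.

(** * Existence for Lipschitz differential equations *)

Section Picard.
Set Implicit Arguments. Unset Strict Implicit.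
Context {R : realType}.

(** Used to pass estimates along the Picard iterates to their pointwise limit. *)
Lemma le_add_geometric (x y c : R) : (forall n, x <= y + c / 2 ^+ n) -> x <= y.
Proof.
move=> xy; rewrite leNgt; apply/negP => yx.
have d0 : 0 < x - y by rewrite subr_gt0.
pose n := (Num.truncn (c / (x - y))).+1.
have nc : c / (x - y) < n%:R by exact: truncnS_gt.
have n2 : n%:R <= 2 ^+ n :> R by rewrite -natrX ler_nat ltnW // ltn_expl.
have p2 : 0 < 2 ^+ n :> R by rewrite exprn_gt0.
have := xy n; rewrite leNgt => /negP; apply.
rewrite -ltrBrDl ltr_pdivrMr // mulrC -ltr_pdivrMr //.
exact: lt_le_trans nc n2.
Qed.

(** The sequences [V n - 2 * c / 2 ^+ n] and [V n + 2 * c / 2 ^+ n] are respectively nondecreasing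
    and nonincreasing, so the supremum of the first lies between them. *)
Lemma geometric_limit (V : nat -> R) c :
  (forall n, `|V n.+1 - V n| <= c / 2 ^+ n) ->
  exists v, forall n, `|v - V n| <= 2 * c / 2 ^+ n.
Proof.
move=> Vc; pose u n := V n - 2 * c / 2 ^+ n; pose w n := V n + 2 * c / 2 ^+ n.
have half n : 2 * c / 2 ^+ n.+1 = c / 2 ^+ n :> R.
  by rewrite exprS; field; rewrite expf_neq0.
have c0 n : 0 <= c / 2 ^+ n by exact: le_trans (Vc n).
have uS n : u n <= u n.+1.
  by have := Vc n; rewrite ler_norml /u half -mulrA => /andP[]; lra.
have wS n : w n.+1 <= w n.
  by have := Vc n; rewrite ler_norml /w half -mulrA => /andP[]; lra.
have uw m n : u m <= w n.
  have uwk k : u k <= w k by have := c0 k; rewrite /u /w -mulrA; lra.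
  have mono : {homo u : i j / (i <= j)%N >-> i <= j}.
    exact: homo_leq (fun=> lexx _) (fun _ _ _ => @le_trans _ _ _ _ _) uS.
  have monow : {homo w : i j / (i <= j)%N >-> j <= i}.
    by apply: homo_leq => // [x y z xy yz]; exact: le_trans yz xy.
  case: (leqP m n) => [/mono/le_trans->//|/ltnW/monow/(le_trans _)->//].
have hs : has_sup (range u).
  by split; [exists (u 0%N); exists 0%N|exists (w 0%N) => _ [m _ <-]].
exists (sup (range u)) => n; rewrite ler_distl; apply/andP; split.
  by apply: ub_le_sup; [case: hs|exists n].
by apply: ge_sup; [case: hs|move=> _ [m _ <-]; exact: uw].
Qed.

Lemma lipschitz_continuous (f : R -> R) k :
  (forall x y, `|f x - f y| <= k * `|x - y|) -> continuous f.
Proof.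
move=> fk x; apply/cvgrPdist_le => e e0.
have k1 : 0 < `|k| + 1 by rewrite ltr_wpDl.
near=> y; rewrite (le_trans (fk x y)) //.
rewrite (@le_trans _ _ ((`|k| + 1) * `|x - y|)) //.
  by rewrite ler_wpM2r // (le_trans (ler_norm k)) // lerDl.
rewrite mulrC -ler_pdivlMr //.
near: y; apply: cvgr_dist_le; first exact: cvg_id.
by rewrite divr_gt0.
Unshelve. all: by end_near. Qed.

(* Picard iteration: in the weight [expR (2 * L * `|z|)] the Picard map contracts
   by a factor 1/2. *)
Lemma ode_exists (g h : R -> R) L B a : 0 < L ->
  (forall x y, `|g x - g y| <= L * `|x - y|) -> (forall x, `|g x| <= B) ->
  continuous h -> (forall z, `|h z| <= B) ->
  exists v, primitive v (fun z => g (v z) + h z) /\ v 0 = a.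
Proof.
move=> L0 gL gB ch hB; have cg := lipschitz_continuous gL.
have crhs v : continuous v -> continuous (fun z => g (v z) + h z).
  move=> cv z; apply: continuousD; last exact: ch.
  by apply: continuous_comp; [exact: cv|exact: cg].
(* The integral part of the Picard map. The default of [xget] is harmless, since every iterate is
   continuous and then a primitive exists. *)
pose P v := xget (fun=> 0 : R)
  [set F | primitive F (fun z => g (v z) + h z) /\ F 0 = 0].
have PP v : continuous v ->
    primitive (P v) (fun z => g (v z) + h z) /\ P v 0 = 0.
  by move=> /crhs/primitive_exists Fex; apply: (xgetPex (fun=> 0 : R) Fex).
pose V := fix V n : R -> R := if n is m.+1 then fun z => a + P (V m) z else fun=> a.
have VP n : continuous (V n) ->
    primitive (V n.+1) (fun z => g (V n z) + h z) /\ V n.+1 0 = a.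
  move=> /PP[PV P0]; split; last by rewrite /= P0 addr0.
  by apply: eq_primitive (primitiveD (primitive_cst a) PV) => z; rewrite add0r.
have cV n : continuous (V n).
  by elim: n => [|n /VP[+ _]]; [move=> z; exact: cst_continuous
                               |exact: primitive_continuous].
have V0 n : V n 0 = a by case: n => [//|n]; have [] := VP n (cV n).
have E (k : R) : primitive (fun z => k / (2 * L) * expR (2 * L * z))
                     (fun z => k * expR (2 * L * z)).
  apply: eq_primitive (primitiveZ (k / (2 * L)) (primitive_expR (2 * L))) => z.
  by field; rewrite ?gt_eqF.
have step (u w : R -> R) (U W : R -> R) c : 0 <= c ->
    primitive U (fun z => g (u z) + h z) ->
    primitive W (fun z => g (w z) + h z) -> U 0 = W 0 ->
    (forall z, `|u z - w z| <= c * expR (2 * L * `|z|)) ->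
    forall z, `|U z - W z| <= c / 2 * expR (2 * L * `|z|).
  move=> c0 Uu Ww UW uw z.
  apply: (@le_trans _ _ (L * c / (2 * L) * expR (2 * L * `|z|)
                         - L * c / (2 * L) * expR (2 * L * 0))).
    apply: (primitive_norm_le (primitiveB Uu Ww) (E (L * c))).
      by rewrite UW subrr.
    move=> y; rewrite (_ : _ - _ = g (u y) - g (w y)); last by ring.
    by rewrite (le_trans (gL _ _)) // -[leRHS]mulrA ler_pM2l.
  rewrite (_ : L * c / (2 * L) = c / 2); last by field; rewrite gt_eqF.
  by rewrite gerBl mulr_ge0 ?expR_ge0 ?divr_ge0.
(* The first increment is at most [2 * B * |z| = A * (2 * L * |z|)], hence at most [A] times the
   weight. *)
pose A := B / L.
have B0 : 0 <= B by exact: le_trans (gB 0).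
have A0 : 0 <= A by rewrite divr_ge0 // ltW.
have VA n z : `|V n.+1 z - V n z| <= A / 2 ^+ n * expR (2 * L * `|z|).
  elim: n z => [|n IHn] z; last first.
    rewrite exprSr invfM mulrA.
    apply: (step (V n.+1) (V n)) => //.
    - by rewrite divr_ge0 ?exprn_ge0.
    - by have [] := VP _ (cV n.+1).
    - by have [] := VP _ (cV n).
    - by rewrite !V0.
  rewrite expr0 divr1.
  have [PV P0] := PP _ (cV 0%N).
  rewrite [V 1%N z - _](_ : _ = P (V 0%N) z); last by rewrite /=; ring.
  have B2 : primitive (fun z => 2 * B * z) (fun=> 2 * B).
    by apply: eq_primitive (primitiveZ (2 * B) primitive_id) => y; rewrite mulr1.
  apply: le_trans (primitive_norm_le PV B2 P0 _ z) _.
    move=> y; rewrite (le_trans (ler_normD _ _)) //.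
    by have := gB (V 0%N y); have := hB y; lra.
  rewrite mulr0 subr0 (_ : 2 * B * _ = A * (2 * L * `|z|)); last first.
    by rewrite /A; field; rewrite gt_eqF.
  rewrite ler_wpM2l // (le_trans _ (expR_ge1Dx _)) //.
  by rewrite lerDr.
have lim z : exists v, forall n,
    `|v - V n z| <= 2 * (A * expR (2 * L * `|z|)) / 2 ^+ n.
  by apply: geometric_limit => n; rewrite mulrAC; exact: VA.
pose v z := projT1 (cid (lim z)).
have vV z n : `|v z - V n z| <= (2 * A) / 2 ^+ n * expR (2 * L * `|z|).
  apply: le_trans (projT2 (cid (lim z)) n) _.
  by rewrite mulrA mulrAC.
(* All iterates have slope at most [2 * B], and this survives the pointwise limit; the resulting
   continuity of [v] allows the Picard map to be applied to it. *)
have vlip x y : `|v x - v y| <= 2 * B * `|x - y|.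
  pose c := 2 * A * expR (2 * L * `|x|) + 2 * A * expR (2 * L * `|y|).
  apply: (@le_add_geometric _ _ c) => n.
  have Vl : `|V n x - V n y| <= 2 * B * `|x - y|.
    case: n => [|n]; first by rewrite subrr normr0 mulr_ge0 ?mulr_ge0.
    have [PV _] := VP n (cV n); apply: (primitive_lipschitz PV) => t.
    rewrite (le_trans (ler_normD _ _)) //.
    by have := gB (V n t); have := hB t; lra.
  have -> : v x - v y = (V n x - V n y) + (v x - V n x) - (v y - V n y) by ring.
  rewrite (le_trans (ler_normB _ _)) //.
  rewrite (le_trans (lerD (ler_normD _ _) (lexx _))) //.
  have := vV x n; have := vV y n; rewrite /c mulrDl ![_ / _ * expR _]mulrAC; lra.
have [Q [Qv Q0]] := primitive_exists (crhs v (lipschitz_continuous vlip)).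
have Wv : primitive (fun z => a + Q z) (fun z => g (v z) + h z).
  by apply: eq_primitive (primitiveD (primitive_cst a) Qv) => z; rewrite add0r.
(* Both [v] and its Picard image are within a multiple of [2 ^- n] of [V n.+1], so [v] is a fixed
   point. *)
suff vE : v = (fun z => a + Q z).
  by exists v; split; [rewrite {1}vE|rewrite vE Q0 addr0].
apply/funext => z; apply/eqP; rewrite -subr_eq0 -normr_le0.
apply: (@le_add_geometric _ _ (4 * A * expR (2 * L * `|z|))) => n.
rewrite add0r.
have W0 : a + Q 0 = V n.+1 0 by rewrite V0 Q0 addr0.
have [PV _] := VP n (cV n).
have c0 : 0 <= 2 * A / 2 ^+ n by apply: divr_ge0; [exact: mulr_ge0|exact: exprn_ge0].
have := step v (V n) _ _ _ c0 Wv PV W0 (fun z => vV z n) z.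
have := vV z n.+1.
rewrite exprSr invfM.
set e := expR _; set p := _ ^+ n.
have e0 : 0 <= A / p * e by apply: mulr_ge0 (expR_ge0 _); apply: divr_ge0 A0 (exprn_ge0 _ _).
have -> : v z - (a + Q z) = (v z - V n.+1 z) - (a + Q z - V n.+1 z) by ring.
move=> D1 D2; rewrite (le_trans (ler_normB _ _)) //.
apply: le_trans (lerD D1 D2) _.
rewrite (_ : 4 * A * e / p = 4 * (A / p * e)); last by ring.
rewrite (_ : _ + _ = 2 * (A / p * e)); first by lra.
by field; rewrite expf_neq0.
Qed.

End Picard.

(** * Periodic solutions by shooting *)

Section Shooting.
Set Implicit Arguments. Unset Strict Implicit.
Context {R : realType}.

Lemma continuous_root (f : R -> R) a b : continuous f -> a <= b ->
  f a <= 0 -> 0 <= f b -> exists c, f c = 0.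
Proof.
move=> cf ab fa fb; have [||c _ fc] := @IVT R f a b 0 ab; last by exists c.
  exact: continuous_subspaceT.
by rewrite ge_min fa le_max fb orbT.
Qed.

Variables (g : R -> R) (L : R).
Hypotheses (L0 : 0 < L) (gL : forall x y, `|g x - g y| <= L * `|x - y|).

Definition solves (h v : R -> R) := primitive v (fun z => g (v z) + h z).

(** Gronwall: multiplied by [expR (- (2 * L + 1) * z)], the left side is nonincreasing. Adding the
    constant [(l - k) ^+ 2] to the squared distance makes the differential inequality
    homogeneous. *)
Lemma solves_upper (h v w : R -> R) l k z :
  solves (fun z => h z + l) v -> solves (fun z => h z + k) w -> 0 <= z ->
  (v z - w z) ^+ 2 + (l - k) ^+ 2 <=
  ((v 0 - w 0) ^+ 2 + (l - k) ^+ 2) * expR ((2 * L + 1) * z).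
Proof.
move=> Hv Hw z0; pose e y := expR (- (2 * L + 1) * y).
have D := primitiveB Hv Hw.
have DE := primitiveM (primitiveD (primitiveM D D) (primitive_cst ((l - k) ^+ 2)))
  (primitive_expR (- (2 * L + 1))).
have := primitive_le (primitiveN DE) _ z0.
rewrite mulr0 expR0 mulr1 mulNr expRN -!expr2 => /(_ _)/[!lerN2] M.
rewrite -ler_pdivrMr ?expR_gt0 //; apply: M => y _.
rewrite -/(e y) addr0.
set x := v y - w y; set d := l - k.
rewrite (_ : g (v y) + (h y + l) - _ = (g (v y) - g (w y)) + d); last first.
  by rewrite /d; ring.
set t := g (v y) - g (w y).
rewrite [leRHS](_ : _ = e y * ((2 * L + 1) * (x ^+ 2 + d ^+ 2) - 2 * x * (t + d)));
  last by rewrite -/(e y); ring.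
rewrite mulr_ge0 ?expR_ge0 // subr_ge0.
have tx : x * t <= L * x ^+ 2.
  rewrite (le_trans (ler_norm _)) // normrM.
  rewrite (le_trans (ler_wpM2l (normr_ge0 _) (gL _ _))) // -/x.
  by rewrite mulrCA -expr2 real_normK ?num_real.
have := sqr_ge0 (x - d); have := mulr_ge0 (ltW L0) (sqr_ge0 d); nra.
Qed.

(** Gronwall in the other direction: the squared distance decays at rate at most [2 * L]. *)
Lemma solves_lower (h v w : R -> R) x y : solves h v -> solves h w -> x <= y ->
  (v x - w x) ^+ 2 * expR (2 * L * x) <= (v y - w y) ^+ 2 * expR (2 * L * y).
Proof.
move=> Hv Hw xy; have D := primitiveB Hv Hw.
have DE := primitiveM (primitiveM D D) (primitive_expR (2 * L)).
have := primitive_le DE _ xy; rewrite -!expr2; apply => z _.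
set u := v z - w z.
rewrite (_ : g (v z) + h z - _ = g (v z) - g (w z)); last by ring.
set t := g (v z) - g (w z).
rewrite [leRHS](_ : _ = 2 * expR (2 * L * z) * (u * t + L * u ^+ 2)); last by ring.
rewrite mulr_ge0 ?mulr_ge0 ?expR_ge0 //.
suff : - (u * t) <= L * u ^+ 2 by lra.
rewrite (le_trans (ler_norm _)) // normrN normrM.
rewrite (le_trans (ler_wpM2l (normr_ge0 _) (gL _ _))) // -/u.
by rewrite mulrCA -expr2 real_normK ?num_real.
Qed.

Lemma solves_unique (h v w : R -> R) : solves h v -> solves h w -> v 0 = w 0 -> v =1 w.
Proof.
move=> Hv Hw vw z; apply/eqP; rewrite -subr_eq0 -sqrf_eq0 eq_le sqr_ge0 andbT.
case: (leP 0 z) => z0.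
  have H0 u : solves h u -> solves (fun z => h z + 0) u.
    by apply: eq_primitive => y; rewrite addr0.
  have := solves_upper (H0 _ Hv) (H0 _ Hw) z0.
  by rewrite vw !subrr expr0n /= !addr0 mul0r.
have := solves_lower Hv Hw (ltW z0); rewrite vw subrr expr0n /= mul0r.
by rewrite pmulr_lle0 ?expR_gt0.
Qed.

Lemma solves_upper1 (h v w : R -> R) l k z :
  solves (fun z => h z + l) v -> solves (fun z => h z + k) w -> 0 <= z <= 1 ->
  `|v z - w z| <= expR (2 * L + 1) * (`|v 0 - w 0| + `|l - k|).
Proof.
move=> Hv Hw /andP[z0 z1]; have e1 : 1 <= expR (2 * L + 1).
  by have := expR_ge1Dx (2 * L + 1); have := L0; lra.
have ez : expR ((2 * L + 1) * z) <= expR (2 * L + 1) by rewrite ler_expR; have := L0; nra.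
rewrite -(ler_pXn2r (n := 2)) ?nnegrE ?mulr_ge0 ?addr_ge0 ?expR_ge0 //.
have := solves_upper Hv Hw z0; rewrite exprMn.
rewrite -[(v z - w z) ^+ 2]real_normK ?num_real //.
rewrite -[(v 0 - w 0) ^+ 2]real_normK ?num_real //.
rewrite -[(l - k) ^+ 2]real_normK ?num_real //.
move: (normr_ge0 (v z - w z)) (normr_ge0 (v 0 - w 0)) (normr_ge0 (l - k)).
move: `|v z - w z| `|v 0 - w 0| `|l - k| => p q r p0 q0 r0 H.
apply: le_trans (_ : p ^+ 2 + r ^+ 2 <= _); first by rewrite lerDl sqr_ge0.
apply: le_trans H _; rewrite mulrC.
apply: ler_pM; rewrite ?expR_ge0 ?addr_ge0 ?sqr_ge0 //.
  by rewrite (le_trans ez) // expr2 ler_peMl ?expR_ge0.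
by rewrite sqrrD mulr2n; have := mulr_ge0 q0 r0; lra.
Qed.

(** Distinct solutions cannot cross: a zero of [v - w] would contradict [solves_lower] between 0 and
    that zero. Hence [v - w] keeps its sign and the square in [solves_lower] can be removed. *)
Lemma solves_lower1 (h v w : R -> R) z : solves h v -> solves h w ->
  w 0 <= v 0 -> 0 <= z <= 1 -> expR (- L) * (v 0 - w 0) <= v z - w z.
Proof.
move=> Hv Hw; rewrite le_eqVlt => /predU1P[vw|vw] /andP[z0 z1].
  by rewrite !(solves_unique Hv Hw (esym vw)) !subrr mulr0.
have wz : 0 <= v z - w z.
  rewrite leNgt; apply/negP => vwz.
  have cD := primitive_continuous (primitiveN (primitiveB Hv Hw)).
  have [||c] := @IVT R (fun y => - (v y - w y)) 0 z 0 z0.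
  - exact: continuous_subspaceT.
  - by rewrite ge_min le_max; apply/andP; split; apply/orP; [left|right]; lra.
  move=> c0z /eqP; rewrite oppr_eq0 => /eqP E.
  have c0 : 0 <= c by rewrite (itvP c0z).
  have := solves_lower Hv Hw c0; rewrite E expr0n /= mul0r mulr0 expR0 mulr1.
  by rewrite leNgt exprn_gt0 // subr_gt0.
have := solves_lower Hv Hw z0; rewrite mulr0 expR0 mulr1 => H.
rewrite -(ler_pXn2r (n := 2)) ?nnegrE ?wz ?mulr_ge0 ?expR_ge0 ?subr_ge0 ?(ltW vw) //.
rewrite exprMn -expRM_natl; apply: le_trans (ler_wpM2l (expR_ge0 _) H) _.
rewrite mulrCA ler_piMr ?sqr_ge0 // -expRD expR_le1.
have z1' : 0 <= 1 - z by rewrite subr_ge0.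
by have := mulr_ge0 (ltW L0) z1'; lra.
Qed.

Variables (h : R -> R) (B : R).
Hypotheses (gB : forall x, `|g x| <= B) (hB : forall z, `|h z| <= B)
  (ch : continuous h) (hper : forall z, h (z + 1) = h z).

Lemma flow_exists (a l : R) : exists vF : (R -> R) * (R -> R),
  [/\ solves (fun z => h z + l) vF.1, vF.1 0 = a, primitive vF.2 vF.1 & vF.2 0 = 0].
Proof.
have B0 : 0 <= B by exact: le_trans (gB 0).
have [|||v [Hv v0]] := @ode_exists R g (fun z => h z + l) L (B + `|l|) a L0 gL.
- by move=> x; rewrite (le_trans (gB x)) // lerDl.
- by move=> z; apply: continuousD; [exact: ch|exact: cst_continuous].
- by move=> z; rewrite (le_trans (ler_normD _ _)) // lerD2r.
have [F [HF F0]] := primitive_exists (primitive_continuous Hv).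
by exists (v, F).
Qed.

(* Nested shooting: for each [l] the initial value [a l] is tuned so that the
   primitive of the solution takes the same value at 0 and 1; [l] is then tuned
   so that the solution itself does. *)
Theorem periodic_solution_exists : exists l (v F : R -> R),
  [/\ solves (fun z => h z + l) v, primitive F v,
      forall z, v (z + 1) = v z & forall z, F (z + 1) = F z].
Proof.
have B0 : 0 <= B by exact: le_trans (gB 0).
pose V a l := (projT1 (cid (flow_exists a l))).1.
pose F a l := (projT1 (cid (flow_exists a l))).2.
have HV a l : solves (fun z => h z + l) (V a l).
  by rewrite /V; case: cid => ? [].
have V0 a l : V a l 0 = a by rewrite /V; case: cid => ? [].
have HF a l : primitive (F a l) (V a l) by rewrite /V /F; case: cid => ? [].
have F0 a l : F a l 0 = 0 by rewrite /F; case: cid => ? [].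
(* By the mean value theorem the difference of the primitives at 1 is a difference of solutions at
   some point of [0, 1], so the flow estimates carry over. *)
have Fup a b l k : `|F a l 1 - F b k 1| <= expR (2 * L + 1) * (`|a - b| + `|l - k|).
  have [c c01] := primitive_mvt (primitiveB (HF a l) (HF b k)) (@ler01 R).
  rewrite !F0 !subr0 mulr1 => ->.
  by have := solves_upper1 (HV a l) (HV b k) c01; rewrite !V0.
(* This expansion in the initial value is what makes the tuned [a l] depend on [l] in a Lipschitz
   way. *)
have Flow a b l : a <= b -> expR (- L) * (b - a) <= F b l 1 - F a l 1.
  move=> ab; have [c c01] := primitive_mvt (primitiveB (HF b l) (HF a l)) (@ler01 R).
  rewrite !F0 !subr0 mulr1 => ->.
  by have := solves_lower1 (HV b l) (HV a l) _ c01; rewrite !V0; apply.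
have Vd a l z : `|V a l z - a| <= (2 * B + `|l|) * `|z|.
  have := primitive_lipschitz (HV a l) _ z 0; rewrite V0 subr0; apply => y.
  rewrite (le_trans (ler_normD _ _)) //.
  have := gB (V a l y); have := hB y; have := ler_normD (h y) l; lra.
have root l : exists a, F a l 1 = 0.
  pose k := 2 * B + `|l|; have k0 : 0 <= k by rewrite addr_ge0 ?mulr_ge0.
  have FV a : `|F a l 1 - a| <= k.
    have [c /andP[c0 c1]] := primitive_mvt (HF a l) (@ler01 R).
    rewrite F0 !subr0 mulr1 => ->; rewrite (le_trans (Vd _ _ _)) //.
    by rewrite (ger0_norm c0) -/k ler_piMr.
  have Fl : forall a b, `|F a l 1 - F b l 1| <= expR (2 * L + 1) * `|a - b|.
    by move=> a b; have := Fup a b l l; rewrite subrr normr0 addr0.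
  apply: (@continuous_root (fun a => F a l 1) (- k) k).
  - exact: lipschitz_continuous Fl.
  - by rewrite (le_trans _ k0) // oppr_le0.
  - by have := FV (- k); rewrite ler_norml => /andP[]; lra.
  - by have := FV k; rewrite ler_norml => /andP[]; lra.
pose a l := projT1 (cid (root l)).
have Fa l : F (a l) l 1 = 0 := projT2 (cid (root l)).
pose K := expR (2 * L + 1) / expR (- L).
(* Since [F (a l) l 1 = F (a k) k 1 = 0], the expansion of [F] in its first argument is controlled
   by its Lipschitz dependence on the second. *)
have alip l k : `|a l - a k| <= K * `|l - k|.
  wlog akl : l k / a k <= a l.
    move=> wl; case: (leP (a k) (a l)) => [/wl//|/ltW /wl].
    by rewrite distrC [`|k - l|]distrC.
  rewrite ger0_norm ?subr_ge0 // /K mulrAC ler_pdivlMr ?expR_gt0 // mulrC.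
  apply: le_trans (Flow _ _ l akl) _; rewrite Fa -[X in X - _](Fa k).
  apply: le_trans (ler_norm _) _.
  by apply: le_trans (Fup _ _ _ _) _; rewrite subrr normr0 add0r distrC.
pose q l := V (a l) l 1 - a l.
have qlip l k : `|q l - q k| <= (expR (2 * L + 1) * (K + 1) + K) * `|l - k|.
  rewrite (_ : q l - q k = (V (a l) l 1 - V (a k) k 1) - (a l - a k)); last first.
    by rewrite /q; ring.
  rewrite (le_trans (ler_normB _ _)) // mulrDl lerD ?alip //.
  have := @solves_upper1 h _ _ _ _ 1 (HV (a l) l) (HV (a k) k); rewrite !V0.
  move=> /(_ _)/le_trans; apply; first by rewrite ler01 lexx.
  by rewrite -mulrA ler_wpM2l ?expR_ge0 // mulrDl mul1r lerD2r.
(* The increment of the solution over [0, 1] is a value of its derivative, which is [l] up to the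
   bounded terms [g] and [h]; so [q] changes sign between [- (2 * B)] and [2 * B]. *)
have ql l : `|q l - l| <= 2 * B.
  have [c _] := primitive_mvt (HV (a l) l) (@ler01 R).
  rewrite V0 -/(q l) subr0 mulr1 => ->; rewrite addrA addrK.
  by rewrite (le_trans (ler_normD _ _)) //; have := gB (V (a l) l c); have := hB c; lra.
have [|||l ql0] := @continuous_root q (- (2 * B)) (2 * B) (lipschitz_continuous qlip).
- by have := B0; lra.
- by have := ql (- (2 * B)); rewrite ler_norml => /andP[]; lra.
- by have := ql (2 * B); rewrite ler_norml => /andP[]; lra.
(* The shifted solution solves the same equation because [h] is periodic, and [q l = 0] equates the
   initial values. *)
have vper z : V (a l) l (z + 1) = V (a l) l z.
  have := @solves_unique (fun z => h z + l) (fun z => V (a l) l (z + 1)) (V (a l) l).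
  apply => //; last first.
    by rewrite add0r V0; apply/eqP; rewrite -subr_eq0 -/(q l) ql0.
  by apply: eq_primitive (primitive_shift 1 (HV (a l) l)) => y; rewrite hper.
exists l, (V (a l) l), (F (a l) l); split => // z.
have := @primitive_inj R (fun z => F (a l) l (z + 1)) (F (a l) l) (V (a l) l).
apply => //; last by rewrite add0r F0 Fa.
by apply: eq_primitive (primitive_shift 1 (HF (a l) l)) => y; rewrite vper.
Qed.

End Shooting.

(** * The maximum principle *)

Section DirectionalDerivatives.
Set Implicit Arguments. Unset Strict Implicit.
Context {R : realType} {V : normedModType R}.
Implicit Types (F : V -> R) (x v : V).

Lemma derive_line F x v : 'D_v F x = 'D_1 (fun h : R => F (h *: v + x)) 0.
Proof.
rewrite /derive; set g1 := fun h => h^-1 *: _; set g2 := fun h => h^-1 *: _.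
suff -> : g1 = g2 by [].
by rewrite funeqE /g1 /g2 => h /=; rewrite addr0 scale0r add0r [_%:A]mulr1.
Qed.

Lemma is_derive_line F x v (d : R) :
  is_derive x v F d <-> is_derive (0 : R) 1 (fun h : R => F (h *: v + x)) d.
Proof.
split=> -[Fx <-].
  by apply: DeriveDef; [exact: (derivable1P F x v).1|rewrite derive_line].
by apply: DeriveDef; [exact: (derivable1P F x v).2|rewrite derive_line].
Qed.

End DirectionalDerivatives.

(** * Comparison of space-time periodic functions at a maximum of their difference *)

Section Comparison.
Set Implicit Arguments. Unset Strict Implicit.
Context {R : realType}.

Lemma primitive_line (V : normedModType R) (F : V -> R) x v :
  (forall y, derivable F y v) ->
  primitive (fun s : R => F (s *: v + x)) (fun s => 'D_v F (s *: v + x)).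
Proof.
move=> Fv s; apply/is_derive_line.
have /derivableP/is_derive_line := Fv (s *: v + x).
by under eq_fun do rewrite addrA -scalerDl -[X in X + s]mulr1.
Qed.

(** If [k s] were positive, [k] would be positive near [s], so [g] would be positive just to the
    right of [s] and [G] would exceed its maximum. *)
Lemma max_derivatives (G g k : R -> R) s : primitive G g -> primitive g k ->
  continuous k -> (forall r, G r <= G s) -> g s = 0 /\ k s <= 0.
Proof.
move=> Gg gk ck Gs.
have g0 : g s = 0.
  have := @derive1_at_max R G (s - 1) (s + 1) s.
  move=> /(_ _ _ _ _)[]; first by lra.
  - by move=> t _; case: (Gg t).
  - by rewrite in_itv /=; lra.
  - by [].
  by move=> _; have [_ <-] := Gg s.
split=> //; rewrite leNgt; apply/negP => k0.
have /nbhs_ballP[e /= e0 ek] : \forall r \near s, 0 < k r.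
  exact: (cvgr_gt (k s) (ck s)).
have h0 : 0 < e / 2 by rewrite divr_gt0.
have sh : s < s + e / 2 by rewrite ltrDl.
have [||c] := @MVT R G g s (s + e / 2) sh.
- by move=> x _; exact: Gg.
- exact/continuous_subspaceT/(primitive_continuous Gg).
rewrite in_itv /= => /andP[sc ce] E.
have : g c * (s + e / 2 - s) <= 0 by rewrite -E subr_le0.
rewrite pmulr_lle0 ?subr_gt0 // leNgt => /negP; apply.
have [c' /andP[c1 c2]] := primitive_mvt gk (ltW sc).
rewrite g0 subr0 => ->; rewrite mulr_gt0 ?subr_gt0 //; apply: ek.
by rewrite /ball /= ler0_norm; lra.
Qed.

Lemma periodic_int (V : zmodType) (f : V -> R) e : (forall x, f (x + e) = f x) ->
  forall (k : int) x, f (x + e *~ k) = f x.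
Proof.
move=> fe; have nat_per n x : f (x + e *+ n) = f x.
  by elim: n => [|n IHn]; rewrite ?mulr0n ?addr0 // mulrSr addrA fe.
case=> n x; first exact: nat_per.
by rewrite NegzE mulrNz -[LHS](nat_per n.+1) -pmulrn subrK.
Qed.

Lemma floor_interval (t : R) : 0 <= t - (Num.floor t)%:~R <= 1.
Proof.
rewrite subr_ge0 floor_le /=.
by have := floorD1_gt t; rewrite intrD; lra.
Qed.

Lemma periodic_cube (d : nat) (x : 'rV[R]_d) : exists2 y : 'rV[R]_d,
  (forall i, 0 <= y 0 i <= 1) & forall f, periodic_x f -> f x = f y.
Proof.
pose k i := Num.floor (x 0 i); pose y := \row_i (x 0 i - (k i)%:~R).
exists y => [i|f fper]; first by rewrite mxE floor_interval.
have -> : x = y + \sum_i e_ R i *~ k i.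
  apply/eqP; rewrite addrC -subr_eq; apply/eqP.
  rewrite [LHS]row_sum_delta; apply: eq_bigr => i _.
  by rewrite -scaler_int; congr (_ *: _); rewrite !mxE; ring.
elim: (index_enum _) => [|i s IHs]; first by rewrite big_nil addr0.
by rewrite big_cons addrCA addrC periodic_int.
Qed.

(* The point is a maximum of [u - w]. *)
Lemma comparison (d : nat) (T : R) (u w : R -> 'rV[R]_d -> R) :
  0 < T -> C12per T u -> C12per T w ->
  exists t x, [/\ dt u t x = dt w t x, grad (u t) x = grad (w t) x
                & lap (u t) x <= lap (w t) x].
Proof.
move=> T0 [ut [ux [cu [du [_ [du1 [_ [du2 cu2]]]]]]]].
move=> [wt [wx [cw [dw [_ [dw1 [_ [dw2 cw2]]]]]]]].
pose W (p : R * 'rV[R]_d) := u p.1 p.2 - w p.1 p.2.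
(* A compact fundamental cell. Periodicity turns the maximum over it into a global one, so no
   boundary case arises. *)
pose A := `[0, T]%classic `*` [set x : 'rV[R]_d | forall i, `[0, 1]%classic (x 0 i)].
have cA : compact A.
  apply: compact_setX; first exact: segment_compact.
  have := @rV_compact R d (fun=> `[0, 1]%classic) (fun=> @segment_compact R 0 1).
  exact.
have cW : continuous W by move=> p; apply: continuousB; [exact: cu|exact: cw].
have A0 : A !=set0.
  exists (0, 0); split => /=; first by rewrite in_itv /= lexx ltW.
  by move=> i; rewrite /= mxE in_itv /= lexx ler01.
have [[t x] _ Wmax] := compact_EVT_max A0 cA (continuous_subspaceT cW).
have gmax s y : u s y - w s y <= u t x - w t x.
  have [z zc zE] := periodic_cube y.
  rewrite (zE _ (ux s)) (zE _ (wx s)).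
  pose k := Num.floor (s / T); pose r := s - T *~ k.
  have -> : s = r + T *~ k by rewrite subrK.
  have uP := @periodic_int _ (fun s => u s z) T (fun s => ut s z) k r.
  have wP := @periodic_int _ (fun s => w s z) T (fun s => wt s z) k r.
  rewrite /= in uP wP; rewrite uP wP.
  apply: (Wmax (r, z)); rewrite inE; split => /=; last first.
    by move=> i; rewrite /= in_itv /= zc.
  rewrite in_itv /= /r -mulrzl.
  have -> : s - k%:~R * T = T * (s / T - k%:~R) by field; rewrite gt_eqF.
  have /andP[? ?] := floor_interval (s / T).
  by rewrite mulr_ge0 ?(ltW T0) //= ler_piMr // ltW.
exists t, x.
have dW i : primitive (fun s => u t (s *: e_ R i + x) - w t (s *: e_ R i + x))
    (fun s => pd i (u t) (s *: e_ R i + x) - pd i (w t) (s *: e_ R i + x)).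
  by apply: primitiveB; apply: primitive_line.
have ddW i : primitive
    (fun s => pd i (u t) (s *: e_ R i + x) - pd i (w t) (s *: e_ R i + x))
    (fun s => pd i (pd i (u t)) (s *: e_ R i + x) - pd i (pd i (w t)) (s *: e_ R i + x)).
  by apply: primitiveB; apply: primitive_line.
have cline (v : R -> 'rV[R]_d -> R) i : continuous (uncurry2 v) ->
    continuous (fun s : R => v t (s *: e_ R i + x)).
  move=> cv s; apply: (@continuous_comp _ _ _ (fun s : R => (t, s *: e_ R i + x)) (uncurry2 v)); last exact: cv.
  apply: (@cvg_pair _ _ _ _ (nbhs t) (nbhs (s *: e_ R i + x))).
    exact: cvg_cst.
  by apply: cvgD; [apply: cvgZr_tmp; exact: cvg_id|exact: cvg_cst].
have M i : pd i (u t) x - pd i (w t) x = 0 /\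
           pd i (pd i (u t)) x - pd i (pd i (w t)) x <= 0.
  have ck : continuous (fun s : R => pd i (pd i (u t)) (s *: e_ R i + x)
                                   - pd i (pd i (w t)) (s *: e_ R i + x)).
    have cu2' := cline (fun t => pd i (pd i (u t))) i (cu2 i i).
    have cw2' := cline (fun t => pd i (pd i (w t))) i (cw2 i i).
    by move=> s; exact: (continuousB (cu2' s) (cw2' s)).
  have := max_derivatives (s := 0) (dW i) (ddW i) ck.
  by rewrite scale0r add0r; apply => r; exact: gmax.
split.
- apply/eqP; rewrite -subr_eq0 /dt; apply/eqP.
  have D (s : R) : is_derive s 1 (fun s : R => u s x - w s x) (dt u s x - dt w s x).
    rewrite /dt !derive1E.
    by have ? := derivableP (du s x); have ? := derivableP (dw s x); exact: is_deriveB.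
  have := @derive1_at_max R (fun s : R => u s x - w s x) (t - 1) (t + 1) t.
  move=> /(_ _ _ _ _)[]; first by lra.
  + by move=> r _; case: (D r).
  + by rewrite in_itv /=; lra.
  + by [].
  by move=> _; have [_ <-] := D t.
- by apply/rowP => i; rewrite !mxE; apply/eqP; rewrite -subr_eq0; apply/eqP; case: (M i).
- by apply: ler_sum => i _; rewrite -subr_le0; case: (M i).
Qed.

End Comparison.

(** * Travelling waves *)

Section TravellingWaves.
Set Implicit Arguments. Unset Strict Implicit.
Context {R : realType}.
Variables (d : nat) (i0 : 'I_d) (T : R).
Implicit Types (f : R -> R) (t : R) (x : 'rV[R]_d).

(** The speed is [1 / T], so that a 1-periodic profile gives a wave of period [T] in time. *)
Definition wave f t x := f (x 0 i0 - t / T).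

Lemma wave_continuous f (k : R) :
  continuous f -> continuous (uncurry2 (fun t x => k * wave f t x)).
Proof.
move=> cf p; rewrite /uncurry2 /wave.
have c0 : continuous (fun q : R * 'rV[R]_d => q.2 0 i0 - q.1 / T).
  move=> q; apply: (@cvgB _ _ _ _ _ (fun q : R * 'rV[R]_d => q.2 0 i0)
                                    (fun q : R * 'rV[R]_d => q.1 / T)).
    apply: (@continuous_comp _ _ _ snd (fun x : 'rV[R]_d => x 0 i0)).
      exact: cvg_snd.
    exact: coord_continuous.
  by apply: cvgMr_tmp; exact: cvg_fst.
have cfw : continuous (fun q : R * 'rV[R]_d => f (q.2 0 i0 - q.1 / T)).
  move=> q; apply: (@continuous_comp _ _ _ (fun q : R * 'rV[R]_d => q.2 0 i0 - q.1 / T) f).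
    exact: c0.
  exact: cf.
apply: cvgM; first exact: cvg_cst.
exact: cfw.
Qed.

(** The scalar [k] lets the rule be iterated: a first derivative is again a wave times the factor
    [(i == i0)%:R]. *)
Lemma is_derive_wave f f1 (k : R) t x i : primitive f f1 ->
  is_derive x (e_ R i) (fun y => k * wave f t y) ((i == i0)%:R * k * wave f1 t x).
Proof.
move=> ff1; apply/is_derive_line.
have := primitive_affine (i == i0)%:R (x 0 i0 - t / T) (primitiveZ k ff1) 0.
rewrite mulr0 add0r mulrA; under eq_fun => h.
  rewrite (_ : _ + _ = (h *: e_ R i + x) 0 i0 - t / T).
  over.
  by rewrite !mxE eqxx /= [i0 == i]eq_sym; ring.
by [].
Qed.

Lemma pd_wave f f1 (k : R) t i : primitive f f1 ->
  pd i (fun y => k * wave f t y) = fun x => (i == i0)%:R * k * wave f1 t x.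
Proof.
by move=> ff1; apply/funext => x; have [_ <-] := is_derive_wave k t x i ff1.
Qed.

Lemma is_derive_wave_time f f1 t x : primitive f f1 ->
  is_derive t 1 (fun s => wave f s x) (- T^-1 * wave f1 t x).
Proof.
move=> ff1; have := primitive_affine (- T^-1) (x 0 i0) ff1 t.
have E s : - T^-1 * s + x 0 i0 = x 0 i0 - s / T by ring.
by rewrite E; under eq_fun do rewrite E.
Qed.

Lemma dt_wave f f1 : primitive f f1 ->
  dt (wave f) = fun t x => - T^-1 * wave f1 t x.
Proof.
move=> ff1; apply/funext => t; apply/funext => x; rewrite /dt derive1E.
by have [_ ->] := is_derive_wave_time t x ff1.
Qed.

Lemma wave1 f t : wave f t = fun x => 1 * wave f t x.
Proof. by apply/funext => x; rewrite mul1r. Qed.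

Lemma grad_wave f f1 t x : primitive f f1 -> grad (wave f t) x = wave f1 t x *: e_ R i0.
Proof.
by move=> ff1; apply/rowP => i; rewrite wave1 !mxE (pd_wave _ _ _ ff1) mulr1 mulrC.
Qed.

Lemma lap_wave f f1 f2 t x : primitive f f1 -> primitive f1 f2 ->
  lap (wave f t) x = wave f2 t x.
Proof.
move=> ff1 ff2; rewrite /lap (bigD1 i0) //= big1 ?addr0 => [|i ii0].
  by rewrite wave1 (pd_wave _ _ _ ff1) (pd_wave _ _ _ ff2) eqxx !mul1r.
by rewrite wave1 (pd_wave _ _ _ ff1) (pd_wave _ _ _ ff2) (negbTE ii0) !mul0r.
Qed.

Lemma wave_C12per f f1 f2 : T != 0 -> primitive f f1 -> primitive f1 f2 ->
  continuous f2 -> (forall z, f (z + 1) = f z) -> C12per T (wave f).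
Proof.
move=> T0 ff1 ff2 cf2 fper.
have cw (k : R -> R) : continuous k -> continuous (uncurry2 (wave k)).
  move=> /(wave_continuous (k := 1)).
  by rewrite (_ : uncurry2 _ = uncurry2 (wave k)) //; apply/funext => p;
    rewrite /uncurry2 mul1r.
have cf := primitive_continuous ff1; have cf1 := primitive_continuous ff2.
have pdw t i : pd i (wave f t) = fun x => (i == i0)%:R * wave f1 t x.
  by rewrite wave1 (pd_wave _ _ _ ff1) mulr1.
have fpN z : f (z - 1) = f z by rewrite -{2}(subrK 1 z) fper.
split=> [t x|]; first by rewrite /wave mulrDl divff // opprD addrA fpN.
split=> [t i x|].
  rewrite /wave !mxE eqxx /=; case: eqP => _; last by rewrite addr0.
  by rewrite mulr1n addrAC fper.
split; first exact: cw.
split=> [t x|]; first by have [] := is_derive_wave_time t x ff1.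
split; first by rewrite (dt_wave ff1); exact: wave_continuous.
split=> [i t x|].
  by rewrite wave1; have [] := is_derive_wave 1 t x i ff1.
split=> [i|].
  by under eq_fun do rewrite pdw; exact: wave_continuous.
split=> [i j t x|i j].
  by rewrite pdw; have [] := is_derive_wave (j == i0)%:R t x i ff2.
by under eq_fun do rewrite pdw (pd_wave _ _ _ ff2); exact: wave_continuous.
Qed.

End TravellingWaves.

(** * Consequences of comparison: periodic profiles, bounds and uniqueness for eigenvalues *)

Section PeriodicComparison.
Set Implicit Arguments. Unset Strict Implicit.
Context {R : realType}.

(** Seen as travelling waves with [d = 1] and [T = 1], functions of one variable fall under
    [comparison]. *)
Lemma periodic_comparison (F f f' G g g' : R -> R) :
  primitive F f -> primitive f f' -> continuous f' -> (forall z, F (z + 1) = F z) ->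
  primitive G g -> primitive g g' -> continuous g' -> (forall z, G (z + 1) = G z) ->
  exists z, f z = g z /\ f' z <= g' z.
Proof.
move=> Ff ff cf Fp Gg gg cg Gp; pose o : 'I_1 := ord0.
have CF := wave_C12per o (oner_neq0 R) Ff ff cf Fp.
have CG := wave_C12per o (oner_neq0 R) Gg gg cg Gp.
have [t [x [_]]] := comparison ltr01 CF CG.
rewrite (grad_wave _ _ _ _ Ff) (grad_wave _ _ _ _ Gg).
rewrite (lap_wave _ _ _ _ Ff ff) (lap_wave _ _ _ _ Gg gg) => /rowP/(_ o).
by rewrite !mxE !eqxx !mulr1 => fg lfg; exists (x 0 o - t / 1).
Qed.

(** At a maximum of [psi - phi], with [phi] an eigenfunction, the first derivatives agree and the
    Laplacians are ordered; subtracting the two relations leaves [b <= l]. *)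
Lemma eigenvalue_lower_bound (d : nat) (T mu b l : R) (H : 'rV[R]_d -> R)
    (m psi : R -> 'rV[R]_d -> R) :
  0 < T -> 0 < mu -> is_eigenvalue T H mu m l -> C12per T psi ->
  (forall t x, dt psi t x + mu * (- lap (psi t) x + H (grad (psi t) x)) + m t x <= - b) ->
  b <= l.
Proof.
move=> T0 mu0 [phi [Cphi Ephi]] Cpsi psib.
have [t [x [E1 E2 E3]]] := comparison T0 Cpsi Cphi.
have arith (D M L1 L2 h : R) : D + mu * (- L1 + h) + M <= - b ->
    l + D + mu * (- L2 + h) = - M -> mu * L1 <= mu * L2 -> b <= l by clear; lra.
have := psib t x; rewrite E1 E2 => psibE.
exact: arith psibE (Ephi t x) (ler_wpM2l (ltW mu0) E3).
Qed.

(** Each eigenfunction serves as the test function [psi] against the other eigenvalue. *)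
Lemma eigenvalue_unique (d : nat) (T mu l k : R) (H : 'rV[R]_d -> R)
    (m : R -> 'rV[R]_d -> R) :
  0 < T -> 0 < mu -> is_eigenvalue T H mu m l -> is_eigenvalue T H mu m k -> l = k.
Proof.
move=> T0 mu0 El Ek; apply/eqP; rewrite eq_le; apply/andP; split.
  case: (El) => phi [Cphi Ephi]; apply: (eigenvalue_lower_bound T0 mu0 Ek Cphi).
  by move=> t x; have := Ephi t x; lra.
case: (Ek) => phi [Cphi Ephi]; apply: (eigenvalue_lower_bound T0 mu0 El Cphi).
by move=> t x; have := Ephi t x; lra.
Qed.

End PeriodicComparison.

(** * The profile equation *)

Section Eigenvalue.
Set Implicit Arguments. Unset Strict Implicit.
Context {R : realType}.

Lemma powR_small (b1 b2 e : R) : 0 < b1 -> 0 < b2 -> 0 < e ->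
  exists a : R, [/\ 0 < a < 1, a `^ b1 < e & a `^ b2 < e].
Proof.
move=> b10 b20 e0.
have small b : 0 < b -> \forall a \near 0^'+, a `^ b < e.
  by move=> b0; apply: (cvgr_lt 0 (powR_cvg0 b0)).
have near1 : \forall a \near (0 : R)^'+, a < 1 by exact: nbhs_right_lt.
have near0 : \forall a \near (0 : R)^'+, 0 < a by exact: nbhs_right_gt.
have [a] : exists a : R, [/\ a < 1, 0 < a, a `^ b1 < e & a `^ b2 < e].
  apply: (@filter_ex _ (0^'+ : set_system R)).
  have sb1 := small _ b10; have sb2 := small _ b20.
  by near=> a; split; near: a.
by case=> a1 a0 ? ?; exists a; rewrite a0.
Unshelve. all: by end_near. Qed.

Lemma segment_bounded (f : R -> R) a b : continuous f -> a <= b ->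
  exists2 C, 0 <= C & forall x, a <= x <= b -> `|f x| <= C.
Proof.
move=> cf ab; have [|c _ fc] := @EVT_max R (fun x => `|f x|) a b ab.
  by apply: continuous_subspaceT => x; apply: continuous_comp; [exact: cf|exact: norm_continuous].
by exists `|f c| => // x xab; apply: fc; rewrite in_itv.
Qed.

Definition clamp (K q : R) := Num.max (- K) (Num.min q K).

Lemma clamp_itv K q : 0 <= K -> - K <= clamp K q <= K.
Proof.
move=> K0; rewrite /clamp le_max lexx ge_max ge_min lexx orbT andbT /=; lra.
Qed.

Lemma clamp_id K q : - K <= q <= K -> clamp K q = q.
Proof. by move=> /andP[Kq qK]; rewrite /clamp (min_idPl qK) (max_idPr Kq). Qed.

Lemma clamp_lipschitz K p q : 0 <= K -> `|clamp K p - clamp K q| <= `|p - q|.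
Proof.
move=> K0; wlog pq : p q / p <= q.
  move=> wl; case: (leP p q) => [/wl//|/ltW /wl].
  by rewrite distrC [`|q - p|]distrC.
rewrite ler_norml /clamp.
have -> : `|p - q| = q - p by rewrite distrC ger0_norm ?subr_ge0.
have KK : Num.max (- K) K = K by apply/max_idPr; lra.
by case: (leP p K) => pK; case: (leP q K) => qK; rewrite ?KK;
  case: (leP (- K) p) => Kp; case: (leP (- K) q) => Kq; apply/andP; split; lra.
Qed.

Variables (H1 dH1 : R -> R) (beta : R).
Hypotheses (H1d : primitive H1 dH1) (dH1c : continuous dH1) (H10 : H1 0 = 0)
  (H1pos : forall q, q != 0 -> 0 < H1 q) (beta01 : 0 < beta < 1)
  (H1pow : forall a q, 0 < a < 1 -> H1 (a `^ beta * q) <= a * H1 q).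

Lemma H1_ge0 q : 0 <= H1 q.
Proof. by have [->|/H1pos/ltW//] := eqVneq q 0; rewrite H10. Qed.

(** The scaling hypothesis gives [H1 q >= H1 1 * q ^ (1 / beta)] for large [q], with an exponent
    above 1. For the remaining [q], nonnegativity of [H1] suffices. *)
Lemma superlinear c : 0 < c -> exists2 C, 0 <= C & forall q, - C <= H1 q - c * q.
Proof.
move=> c0; have /andP[b0 b1] := beta01.
have H11 : 0 < H1 1 by apply: H1pos; exact: oner_neq0.
have b1' : 0 < 1 - beta by rewrite subr_gt0.
have [a0 [/andP[a00 a01] _ a0s]] := powR_small b0 b1' (divr_gt0 H11 c0).
pose q0 := (a0 `^ beta)^-1.
have a0b : 0 < a0 `^ beta by exact: powR_gt0.
have q00 : 0 < q0 by rewrite invr_gt0.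
have q01 : 1 < q0.
  rewrite invf_gt1 //; have := gt0_ltr_powR b0 _ _ a01.
  by rewrite powR1; apply; rewrite nnegrE // ltW.
exists (c * q0) => [|q]; first by rewrite mulr_ge0 ?ltW.
case: (leP q q0) => qq0; first by have := H1_ge0 q; have := ler_wpM2l (ltW c0) qq0; lra.
have q_gt0 : 0 < q by exact: lt_trans qq0.
(* Chosen so that [a ^ beta * q = 1], which compares [H1 q] with [H1 1]. *)
pose a := q `^ (- beta^-1).
have a_gt0 : 0 < a by exact: powR_gt0.
have ab : a `^ beta = q^-1.
  by rewrite /a -powRrM mulNr mulVf ?gt_eqF // powR_inv1 // ltW.
have aa0 : a < a0.
  rewrite ltNge; apply/negP => a0a.
  have : a0 `^ beta <= a `^ beta.
    by apply: (ge0_ler_powR (ltW b0)); rewrite // nnegrE ltW.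
  by rewrite ab leNgt => /negP; apply; rewrite -[ltRHS]invrK ltf_pV2.
have aH : H1 1 <= a * H1 q.
  by have := @H1pow a q; rewrite ab mulVf ?gt_eqF //; apply; rewrite a_gt0 (lt_trans aa0).
have aE : a = q^-1 * a `^ (1 - beta).
  rewrite -ab -powRD; last by rewrite (gt_eqF a_gt0) implybT.
  by rewrite addrC subrK powRr1 ?ltW.
have a1b : a `^ (1 - beta) < H1 1 / c.
  by apply: lt_trans a0s; apply: (gt0_ltr_powR b1'); rewrite ?nnegrE ?ltW.
have cq : c * q <= H1 q; last by have := mulr_gt0 c0 q00; lra.
rewrite -(ler_pM2l a_gt0) (le_trans _ aH) //.
rewrite {1}aE mulrCA mulrAC mulVf ?gt_eqF // mul1r.
by rewrite -ler_pdivlMl // mulrC ltW.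
Qed.

(* The Hamiltonian is truncated at the a priori bound [K] of the solutions, so
   that the truncation disappears a posteriori. *)
Lemma wave_profile (m : R -> R) (T mu : R) : 0 < T -> 0 < mu ->
  continuous m -> (forall z, `|m z| <= 1) -> (forall z, m (z + 1) = m z) ->
  exists l F (v : R -> R), [/\ primitive F v,
    primitive v (fun z => H1 (v z) - (mu * T)^-1 * v z + (m z + l) / mu),
    forall z, F (z + 1) = F z & forall z, v (z + 1) = v z].
Proof.
move=> T0 mu0 cm m1 mper; pose c := (mu * T)^-1.
have c0 : 0 < c by rewrite invr_gt0 mulr_gt0.
have [C C0 HC] := superlinear c0.
(* Minus [K] will bound [v'] from below: [C] comes from the truncated Hamiltonian, and each of the
   forcing and the shooting parameter contributes [1 / mu]. *)
pose K := C + 2 / mu; have i0 : 0 < mu^-1 by rewrite invr_gt0.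
have K0 : 0 <= K by rewrite addr_ge0 // divr_ge0 // ltW.
pose G q := H1 q - c * q; pose dG q := dH1 q - c * 1.
have GdG : primitive G dG by apply: primitiveB H1d (primitiveZ c primitive_id).
have cdG : continuous dG.
  by move=> q; apply: (@continuousB _ _ _ dH1 (fun=> c * 1)); [exact: dH1c|exact: cst_continuous].
have KK : - K <= K by lra.
have [L' L'0 dGL'] := segment_bounded cdG KK.
pose L := L' + 1; have L0 : 0 < L by rewrite ltr_wpDl.
pose g q := G (clamp K q).
have gL x y : `|g x - g y| <= L * `|x - y|.
  suff GL p q : - K <= p <= K -> - K <= q <= K -> `|G p - G q| <= L * `|p - q|.
    apply: le_trans (GL _ _ (clamp_itv x K0) (clamp_itv y K0)) _.
    by rewrite ler_pM2l // clamp_lipschitz.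
  wlog pq : p q / p <= q.
    move=> wl pK qK; case: (leP p q) => [/wl->//|/ltW /wl].
    by rewrite distrC [`|q - p|]distrC => ->.
  move=> /andP[pK _] /andP[_ qK]; rewrite distrC [`|p - q|]distrC.
  have [r /andP[pr rq] ->] := primitive_mvt GdG pq.
  rewrite normrM ler_wpM2r // (le_trans (dGL' r _)) ?lerDl //.
  by rewrite (le_trans pK pr) (le_trans rq qK).
have g0 : g 0 = 0.
  by rewrite /g clamp_id ?oppr_le0 ?K0 // /G H10 mulr0 subrr.
have gB x : `|g x| <= L * K + mu^-1.
  rewrite /g; apply: le_trans (_ : L * K <= _); last by rewrite lerDl ltW.
  have := gL (clamp K x) 0; rewrite g0 !subr0 /g clamp_id ?clamp_itv //.
  move=> /le_trans; apply; rewrite ler_pM2l // ler_norml clamp_itv //.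
pose h z := m z / mu.
have hB z : `|h z| <= mu^-1.
  by rewrite normrM (gtr0_norm i0) ler_piMl // ltW.
have hB' z : `|h z| <= L * K + mu^-1.
  by rewrite (le_trans (hB z)) // lerDr mulr_ge0 // ltW.
have ch : continuous h.
  by move=> z; apply: (@cvgM _ _ _ _ m (fun=> mu^-1)); [exact: cm|exact: cvg_cst].
have hper z : h (z + 1) = h z by rewrite /h mper.
have [l [v [F [Hv HF vper Fper]]]] := periodic_solution_exists L0 gL gB hB' ch hper.
have cg : continuous g := lipschitz_continuous gL.
have cv' : continuous (fun z => g (v z) + (h z + l)).
  have cv := primitive_continuous Hv.
  have cl : continuous (fun _ : R => l) by move=> z; exact: cst_continuous.
  have cgv : continuous (fun z => g (v z)).
    by move=> z; apply: continuous_comp; [exact: cv|exact: cg].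
  by move=> z; exact: (continuousD (cgv z) (continuousD (ch z) (cl z))).
have P0 := @primitive_cst R 0.
have c00 : continuous (fun _ : R => 0 : R) by move=> z; exact: cst_continuous.
(* Comparison of [F] with the constant 0 yields a point where [v] vanishes and [v' >= 0]; there the
   equation bounds [l] from below. *)
have [z0 [/esym vz0]] := periodic_comparison P0 P0 c00 (fun=> erefl) HF Hv cv' Fper.
rewrite vz0 g0 add0r => hl0.
have lmu : - mu^-1 <= l by have := hB z0; rewrite ler_norml => /andP[]; lra.
have vK z : - K <= g (v z) + (h z + l).
  have : - C <= g (v z) by exact: HC.
  by have := hB z; rewrite ler_norml /K => /andP[]; lra.
(* The one-sided bound on [v'] is enough: integrating forward from the zero [z0] bounds [v] below,
   and integrating up to the next zero [z0 + 1] bounds it above. *)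
have vr r : 0 <= r <= 1 -> - K <= v (z0 + r) <= K.
  move=> /andP[r0 r1]; apply/andP; split.
    have zr : z0 <= z0 + r by rewrite lerDl.
    have [x _] := primitive_mvt Hv zr.
    rewrite vz0 subr0 (_ : z0 + r - z0 = r); last by ring.
    move=> ->; apply: le_trans (_ : - K * r <= _); last exact: ler_wpM2r (vK x).
    by rewrite mulNr lerN2 ler_piMr.
  have zr : z0 + r <= z0 + 1 by rewrite lerD2l.
  have [x _] := primitive_mvt Hv zr.
  rewrite vper vz0 sub0r (_ : z0 + 1 - _ = 1 - r); last by ring.
  move=> E; rewrite -lerN2 E; have r1' : 0 <= 1 - r by rewrite subr_ge0.
  apply: le_trans (_ : - K * (1 - r) <= _); last exact: ler_wpM2r (vK x).
  by rewrite mulNr lerN2 ler_piMr // gerBl.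
have vE z : - K <= v z <= K.
  pose k := Num.floor (z - z0).
  have -> : v z = v (z0 + (z - z0 - k%:~R)).
    by rewrite -[RHS](periodic_int vper k); congr v; ring.
  exact: vr (floor_interval _).
(* The profile equation was divided by [mu], so the shooting parameter is the eigenvalue over
   [mu]. *)
exists (l * mu), F, v; split => //.
apply: eq_primitive Hv => z.
rewrite /g clamp_id // /G /h /c; field.
by rewrite !gt_eqF.
Qed.

End Eigenvalue.

(** * The eigenvalues *)

Section CosineWave.
Set Implicit Arguments. Unset Strict Implicit.
Context {R : realType}.

(** Kept abstract: [freqE] only serves to derive positivity and the periodicity of sine and
    cosine. *)
Variable freq : R.
Hypothesis freqE : freq = pi *+ 2.

Lemma freq_gt0 : 0 < freq.
Proof. by rewrite freqE mulrn_wgt0 // pi_gt0. Qed.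

Lemma primitive_sin : primitive (fun z => sin (freq * z)) (fun z => freq * cos (freq * z)).
Proof.
have S : primitive (@sin R) cos by move=> x; exact: is_derive_sin.
move=> x; have := primitive_affine freq 0 S x; rewrite addr0.
by under eq_fun do rewrite addr0.
Qed.

Lemma primitive_cos :
  primitive (fun z => cos (freq * z)) (fun z => - (freq * sin (freq * z))).
Proof.
have S : primitive (@cos R) (fun x => - sin x) by move=> x; exact: is_derive_cos.
move=> x; have := primitive_affine freq 0 S x; rewrite addr0 mulrN.
by under eq_fun do rewrite addr0.
Qed.

Lemma sin_periodic z : sin (freq * (z + 1)) = sin (freq * z).
Proof. by rewrite mulrDr mulr1 {2}freqE sinD2pi. Qed.

Lemma cos_periodic z : cos (freq * (z + 1)) = cos (freq * z).
Proof. by rewrite mulrDr mulr1 {2}freqE cosD2pi. Qed.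

Variables (d : nat) (T : R) (H : 'rV[R]_d -> R) (i0 : 'I_d).
Hypotheses (T0 : 0 < T) (HH : assumptions_H H).

(** Gradients of waves along [i0] stay on this axis, so only the restriction of [H] to it enters. *)
Let H1 (q : R) : R := H (q *: e_ R i0).
Let dH1 (q : R) : R := pd i0 H (q *: e_ R i0).
Let m := wave i0 T (fun z => cos (freq * z)).

Lemma profile_axis : [/\ primitive H1 dH1, continuous dH1, H1 0 = 0
  & forall q, q != 0 -> 0 < H1 q].
Proof.
have [[_ [dH [cdH _]]] [H00 [Hpos _]]] := HH; split.
- move=> q; have := primitive_line 0 (dH i0) q; rewrite addr0.
  by under eq_fun do rewrite addr0.
- move=> q; apply: (@continuous_comp _ _ _ (fun q : R => q *: e_ R i0) (pd i0 H)).
    by apply: cvgZr_tmp; exact: cvg_id.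
  exact: cdH.
- by rewrite /H1 scale0r.
- move=> q q0; apply: Hpos; rewrite scaler_eq0 (negbTE q0) /=.
  by apply/eqP => /matrixP/(_ 0 i0); rewrite !mxE !eqxx => /eqP; rewrite oner_eq0.
Qed.

Lemma profile_power : exists2 beta : R, 0 < beta < 1 &
  forall a q, 0 < a < 1 -> H1 (a `^ beta * q) <= a * H1 q.
Proof.
have [_ [_ [_ [_ [_ [beta [b01 Hb]]]]]]] := HH; exists beta => // a q a01.
by rewrite /H1 -scalerA; exact: Hb.
Qed.

Lemma m_C12per : C12per T m.
Proof.
have := @wave_C12per R d i0 T _ _ _ (lt0r_neq0 T0) primitive_cos
  (primitiveN (primitiveZ freq primitive_sin)); apply; last exact: cos_periodic.
move=> z; have C := primitive_continuous (primitiveN (primitiveZ freq (primitiveZ freq primitive_cos))).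
exact: C.
Qed.

(* Negativity: [J' = H1 \o v >= 0] and [J (z + 1) = J z - l / mu] give [l <= 0]; if
   [l = 0] then [J] is periodic and nondecreasing, hence constant, forcing [v = 0]. *)
Lemma eigenvalue_exists mu : 0 < mu -> exists2 l, is_eigenvalue T H mu m l & l < 0.
Proof.
move=> mu0; have [H1d dH1c H10 H1pos] := profile_axis.
have [beta b01 H1pow] := profile_power.
have cc : continuous (fun z : R => cos (freq * z)) := primitive_continuous primitive_cos.
have [l [F [v [HF Hv Fper vper]]]] := wave_profile H1d dH1c H10 H1pos b01 H1pow T0 mu0
  cc (fun z => cos_max _) cos_periodic.
have T0' := lt0r_neq0 T0; have mu0' := lt0r_neq0 mu0.
have cv := primitive_continuous Hv; have cH1 := primitive_continuous H1d.
exists l.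
  exists (wave i0 T F); split.
    apply: (wave_C12per _ T0' HF Hv _ Fper).
    have cH1v : continuous (fun z => H1 (v z)).
      by move=> z; apply: continuous_comp; [exact: cv|exact: cH1].
    have ccl : continuous (fun z : R => (cos (freq * z) + l) / mu).
      rewrite (_ : (fun z => _) = fun z => mu^-1 * (cos (freq * z) + l)).
        exact: primitive_continuous (primitiveZ mu^-1 (primitiveD primitive_cos (primitive_cst l))).
      by apply/funext => z; rewrite mulrC.
    have cmv : continuous (fun z : R => (mu * T)^-1 * v z) := primitive_continuous (primitiveZ (mu * T)^-1 Hv).
    by move=> z; exact: (continuousD (continuousB (cH1v z) (cmv z)) (ccl z)).
  move=> t x; rewrite (dt_wave _ _ HF) (lap_wave _ _ _ _ HF Hv) (grad_wave _ _ _ _ HF).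
  rewrite -/(H1 _) /m /wave; set z := x 0 i0 - t / T; field.
  by rewrite T0' mu0'.
(* Obtained by solving the profile equation for [H1 (v z)] and integrating term by term. *)
pose J z := v z + (mu * T)^-1 * F z - (mu * freq)^-1 * sin (freq * z) - l / mu * z.
have J' : primitive J (fun z => H1 (v z)).
  have := primitiveB (primitiveB (primitiveD Hv (primitiveZ (mu * T)^-1 HF))
    (primitiveZ (mu * freq)^-1 primitive_sin)) (primitiveZ (l / mu) primitive_id).
  apply: eq_primitive => z; field.
  by rewrite T0' mu0' (lt0r_neq0 freq_gt0).
have H1v0 z : 0 <= H1 (v z) by exact: H1_ge0 H10 H1pos _.
have Jle x y : x <= y -> J x <= J y by apply: (primitive_le J').
have Jper z : J (z + 1) = J z - l / mu.
  by rewrite /J vper Fper sin_periodic; ring.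
have l0 : l <= 0.
  have J01 : J 0 <= J (0 + 1) by rewrite Jle // add0r.
  have : l / mu <= 0 by move: J01; rewrite Jper; lra.
  by rewrite pmulr_lle0 // invr_gt0.
rewrite lt_neqAle l0 andbT; apply/eqP => l_eq0.
have Jper0 z : J (z + 1) = J z by rewrite Jper l_eq0 mul0r subr0.
have Jcst z : J 0 = J z.
  rewrite -(subrK (Num.floor z)%:~R z) periodic_int //.
  have /andP[r0 r1] := floor_interval z.
  by apply/eqP; rewrite eq_le Jle //= -[J 0]Jper0 add0r Jle.
have v0 z : v z = 0.
  apply/eqP; apply: contraT => /H1pos; suff -> : H1 (v z) = 0 by rewrite ltxx.
  suff J0 : primitive J (fun=> 0) by exact: (primitive_unique J' J0 z).
  by rewrite (_ : J = fun=> J 0); [exact: primitive_cst|apply/funext => y; rewrite -Jcst].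
have v00 : primitive v (fun=> 0).
  by rewrite (_ : v = fun=> 0); [exact: primitive_cst|exact/funext].
(* With [v = 0] and [l = 0] the profile equation at 0 reads [1 / mu = 0]. *)
have := primitive_unique Hv v00 0; rewrite !v0 H10 !mulr0 cos0 l_eq0 subrr add0r addr0.
by move=> /eqP; rewrite mul1r invr_eq0 (negbTE mu0').
Qed.

(* The test function [psi] with [dt psi = - m]. *)
Lemma eigenvalue_small : exists2 C, 0 <= C &
  forall mu l, 0 < mu -> is_eigenvalue T H mu m l -> - (mu * C) <= l.
Proof.
have [H1d _ _ _] := profile_axis.
have TT : - T <= T by have := T0; lra.
have [C C0 HC] := segment_bounded (primitive_continuous H1d) TT.
(* Here [T * freq] bounds the Laplacian of [psi], and [C] bounds [H1] on the range [-T, T] of its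
   slope. *)
exists (T * freq + C) => [|mu l mu0 El].
  by rewrite addr_ge0 // mulr_ge0 // ltW // freq_gt0.
have fr0 := lt0r_neq0 freq_gt0; have T0' := lt0r_neq0 T0.
have S1 : primitive (fun z => T / freq * sin (freq * z)) (fun z => T * cos (freq * z)).
  by apply: eq_primitive (primitiveZ (T / freq) primitive_sin) => z; field.
have S2 := primitiveZ T primitive_cos.
have cS2 := primitive_continuous (primitiveZ T (primitiveN (primitiveZ freq primitive_sin))).
have Sper z : T / freq * sin (freq * (z + 1)) = T / freq * sin (freq * z).
  by rewrite sin_periodic.
apply: (eigenvalue_lower_bound T0 mu0 El (wave_C12per i0 T0' S1 S2 cS2 Sper)).
move=> t x; rewrite (dt_wave _ _ S1) (lap_wave _ _ _ _ S1 S2) (grad_wave _ _ _ _ S1).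
rewrite -/(H1 _) /m /wave; set z := x 0 i0 - t / T.
have -> : - T^-1 * (T * cos (freq * z)) = - cos (freq * z) by field.
rewrite addrAC addNr add0r opprK; apply: ler_wpM2l; first exact: ltW.
apply: lerD.
  by rewrite mulrN opprK mulrA ler_piMr ?sin_le1 // mulr_ge0 // ltW // freq_gt0.
rewrite (le_trans (ler_norm _)) // HC //.
by have := cos_le1 (freq * z); have := cos_geN1 (freq * z); have := T0; nra.
Qed.

(* The test function [psi] with [mu * lap psi = m]. *)
Lemma eigenvalue_large e : 0 < e -> exists2 mu, 1 <= mu &
  forall l, is_eigenvalue T H mu m l -> - e <= l.
Proof.
move=> e0; have [H1d _ _ _] := profile_axis.
have [beta /andP[b0 b1] H1pow] := profile_power.
have fr0 := lt0r_neq0 freq_gt0; have T0' := lt0r_neq0 T0.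
have K0 : 0 < freq^-1 by rewrite invr_gt0 freq_gt0.
have KK : - freq^-1 <= freq^-1 by lra.
have [C C0 HC] := segment_bounded (primitive_continuous H1d) KK.
have K1 : 0 < (freq * T)^-1 by rewrite invr_gt0 mulr_gt0 ?freq_gt0.
(* The residual of the test function will be at most [s / (freq * T) + a ^ (1 - beta) * C], so
   making both powers of [a] smaller than [E] brings it below [e]; the 1 ensures [mu >= 1]. *)
pose E := Num.min 1 (e / ((freq * T)^-1 + C)).
have E0 : 0 < E by rewrite lt_min ltr01 divr_gt0 // ltr_pwDl.
have b1' : 0 < 1 - beta by rewrite subr_gt0.
have [a [a01 ab a1b]] := powR_small b0 b1' E0.
(* With [mu = 1 / s] the slope of [psi] carries the factor [a ^ beta], so the scaling hypothesis
   bounds [mu * H] by [a ^ (1 - beta) * C], which tends to 0 although [mu] grows. *)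
have /andP[a0 a1] := a01; pose s := a `^ beta.
have s0 : 0 < s by exact: powR_gt0.
have s1 : s <= 1 by rewrite ltW // (lt_le_trans ab) // ge_min lexx.
have mu0 : 0 < s^-1 by rewrite invr_gt0.
exists s^-1; first by rewrite invf_ge1.
move=> l El.
have S1 : primitive (fun z => - (s / (freq * freq)) * cos (freq * z))
                    (fun z => s / freq * sin (freq * z)).
  by apply: eq_primitive (primitiveZ (- (s / (freq * freq))) primitive_cos) => z; field.
have S2 : primitive (fun z => s / freq * sin (freq * z)) (fun z => s * cos (freq * z)).
  by apply: eq_primitive (primitiveZ (s / freq) primitive_sin) => z; field.
have cS2 := primitive_continuous (primitiveZ s primitive_cos).
have Sper z : - (s / (freq * freq)) * cos (freq * (z + 1)) =
              - (s / (freq * freq)) * cos (freq * z).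
  by rewrite cos_periodic.
apply: (eigenvalue_lower_bound T0 mu0 El (wave_C12per i0 T0' S1 S2 cS2 Sper)).
move=> t x; rewrite (dt_wave _ _ S1) (lap_wave _ _ _ _ S1 S2) (grad_wave _ _ _ _ S1).
rewrite -/(H1 _) /m /wave; set z := x 0 i0 - t / T; rewrite opprK.
set h := H1 _.
have -> : - T^-1 * (s / freq * sin (freq * z)) + s^-1 * (- (s * cos (freq * z)) + h)
    + cos (freq * z) = s * (freq * T)^-1 * - sin (freq * z) + s^-1 * h.
  by field; rewrite T0' fr0 lt0r_neq0.
have hC : s^-1 * h <= a `^ (1 - beta) * C.
  have aE : a = s * a `^ (1 - beta).
    rewrite -powRD; last by rewrite (gt_eqF a0) implybT.
    by rewrite addrC subrK powRr1 ?ltW.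
  rewrite ler_pdivrMl // mulrA -aE /h -mulrA.
  apply: le_trans (H1pow _ _ a01) _; rewrite ler_pM2l //.
  rewrite (le_trans (ler_norm _)) // HC //.
  by have := sin_le1 (freq * z); have := sin_geN1 (freq * z); nra.
have hs : s * (freq * T)^-1 * - sin (freq * z) <= s * (freq * T)^-1.
  apply: ler_piMr; first by rewrite mulr_ge0 // ltW.
  by have := sin_geN1 (freq * z); lra.
apply: le_trans (lerD hs hC) _.
have KC : 0 < (freq * T)^-1 + C by rewrite ltr_pwDl.
apply: (@le_trans _ _ (E * ((freq * T)^-1 + C))).
  by rewrite mulrDr lerD // ler_wpM2r // ltW.
by rewrite -ler_pdivlMr // ge_min lexx orbT.
Qed.

End CosineWave.

(** * Failure of both monotonicities for the cosine wave *)

Theorem theorem1p9 (R : realType) (d : nat) (T : R) (H : 'rV[R]_d -> R) :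
  (0 < d)%N -> 0 < T -> assumptions_H H ->
  exists m : R -> 'rV[R]_d -> R,
    C12per T m /\
    exists lamH : R -> R,
      (* lamH mu is the (unique) eigenvalue lambda_H(m, mu) for every mu > 0 *)
      (forall mu, 0 < mu ->
         is_eigenvalue T H mu m (lamH mu) /\
         forall l, is_eigenvalue T H mu m l -> l = lamH mu) /\
      (* mu |-> lambda_H(m, mu) is not monotonic on (0, +oo) *)
      ~ (forall mu1 mu2, 0 < mu1 -> mu1 <= mu2 -> lamH mu1 <= lamH mu2) /\
      ~ (forall mu1 mu2, 0 < mu1 -> mu1 <= mu2 -> lamH mu2 <= lamH mu1).
Proof.
move=> d0 T0 HH; pose i0 := Ordinal d0; pose freq : R := pi *+ 2.
pose m := wave i0 T (fun z => cos (freq * z)).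
exists m; split; first exact: (m_C12per (freq := freq) erefl i0 T0).
(* The default 0 can only be taken for [mu <= 0], outside the range considered. *)
pose lam mu := xget 0 [set l | is_eigenvalue T H mu m l].
have lamP mu : 0 < mu -> is_eigenvalue T H mu m (lam mu).
  move=> mu0; have [l El _] := eigenvalue_exists (freq := freq) erefl i0 T0 HH mu0.
  by apply: (xgetPex 0 (P := [set l | is_eigenvalue T H mu m l])); exists l.
have lam_lt0 mu : 0 < mu -> lam mu < 0.
  move=> mu0; have [l El l0] := eigenvalue_exists (freq := freq) erefl i0 T0 HH mu0.
  by rewrite (eigenvalue_unique T0 mu0 (lamP _ mu0) El).
exists lam; split; [|split].
- move=> mu mu0; split; first exact: lamP.
  by move=> l El; exact: eigenvalue_unique T0 mu0 El (lamP _ mu0).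
- move=> incr; have [C C0 HC] := eigenvalue_small (freq := freq) erefl i0 T0 HH.
  have l1 := lam_lt0 1 ltr01.
  have C1 : 0 < C + 1 by lra.
  (* Small enough that [- (mu * C) >= lam 1 + mu > lam 1]; the added 1 makes the inequality
     strict. *)
  pose mu := Num.min 1 (- lam 1 / (C + 1)).
  have mu0 : 0 < mu by rewrite lt_min ltr01 divr_gt0 // oppr_gt0.
  have mu1 : mu <= 1 by rewrite ge_min lexx.
  have := HC _ _ mu0 (lamP _ mu0); have := incr _ _ mu0 mu1.
  have : mu * (C + 1) <= - lam 1 by rewrite -ler_pdivlMr // ge_min lexx orbT.
  have := mu0; lra.
- move=> decr; have l1 := lam_lt0 1 ltr01.
  (* For this [mu >= 1] the eigenvalue is at least [lam 1 / 2], which exceeds the negative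
     [lam 1]. *)
  have [|mu mu1 Hmu] := eigenvalue_large (freq := freq) erefl i0 T0 HH (e := - lam 1 / 2); first by lra.
  have mu0 : 0 < mu by exact: lt_le_trans mu1.
  by have := Hmu _ (lamP _ mu0); have := decr _ _ ltr01 mu1; lra.
Qed.
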